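(* Let $p$ be a prime and $F\colon\mathbb F_p^n\to\mathbb F_p^m$ a function with $m\le n/2$. Then there exists an $\mathbb F_p$-linear function $L\colon\mathbb F_p^n\to\mathbb F_p^m$ such that $F+L$ is surjective. *)

(* Defs.v *)
From HB Require Import structures.
From mathcomp Require Export all_boot all_order all_algebra.

#[export] Set Implicit Arguments.
#[export] Unset Strict Implicit.
#[export] Unset Printing Implicit Defensive.

(* Main.v *)
Require Import Defs.
From mathcomp Require Import zify ring.
Import GRing.Theory.
Local Open Scope ring_scope.

(** For distinct [x1] and [x2] and a uniformly random matrix [M], the vector
    [(x1 - x2) *m M] is uniform, so the expected number of collisions of
    [x |-> F x + x *m M] is [N + N * (N - 1) / q], where [N] and [q] are the
    sizes of the domain and the codomain. By Cauchy-Schwarz a map that misses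
    a point has at least [N ^ 2 / (q - 1)] collisions. If every [M] gave such a
    map, averaging would yield [N <= (q - 1) ^ 2], contradicting [q ^ 2 <= N]. *)

(** Cauchy-Schwarz against the constant 1: after doubling, both sides are sums over pairs [(i, j)],
    compared termwise by [2 * (f i * f j) <= f i ^ 2 + f j ^ 2]. *)
Lemma sum_sqr_leq_card (I : finType) (A : {set I}) (f : I -> nat) :
  ((\sum_(i in A) f i) ^ 2 <= #|A| * \sum_(i in A) f i ^ 2)%N.
Proof.
have sqrE : ((\sum_(i in A) f i) ^ 2 =
    \sum_(i in A) \sum_(j in A) f i * f j)%N.
  by rewrite -mulnn big_distrl; apply: eq_bigr => i _; rewrite big_distrr.
have cardE : (2 * (#|A| * \sum_(i in A) f i ^ 2) =
    \sum_(i in A) \sum_(j in A) (f i ^ 2 + f j ^ 2))%N.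
  under [RHS]eq_bigr => i _ do rewrite big_split sum_nat_const.
  by rewrite big_split sum_nat_const -big_distrr /= addnn mul2n.
rewrite -(leq_pmul2l (ltn0Sn 1)) cardE sqrE big_distrr.
apply: leq_sum => i _; rewrite big_distrr; apply: leq_sum => j _.
exact: nat_Cauchy.
Qed.

(** Pairs are ordered and include the diagonal, which makes the count equal to the sum of the
    squared fibre sizes. *)
Definition collisions (T R : finType) (g : T -> R) : nat :=
  (\sum_x \sum_x' (g x == g x'))%N.

Lemma card_sqr_leq_collisions (T R : finType) (g : T -> R) :
  (#|T| ^ 2 <= #|g @: T| * collisions g)%N.
Proof.
pose fib y := (\sum_(x | g x == y) 1)%N.
have gT x : true -> g x \in g @: T by move=> _; apply: imset_f.
have -> : #|T| = (\sum_(y in g @: T) fib y)%N.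
  by rewrite -sum1_card (partition_big g (mem (g @: T))).
have -> : collisions g = (\sum_(y in g @: T) fib y ^ 2)%N.
  rewrite /collisions (partition_big g (mem (g @: T))) //=.
  apply: eq_bigr => y _.
  rewrite -mulnn {1}/fib big_distrl /=; apply: eq_bigr => x /eqP ->.
  rewrite mul1n /fib [RHS]big_mkcond; apply: eq_bigr => x' _.
  by rewrite eq_sym; case: eqP.
exact: sum_sqr_leq_card.
Qed.

Section RandomMatrix.
Variables (K : finFieldType) (n m : nat).
Implicit Types (x : 'rV[K]_n) (v : 'rV[K]_m) (M : 'M[K]_(n, m)).

(** Translations of the matrix space permute the fibres of [M |-> x *m M] transitively, so these all
    have the same size. *)
Lemma card_mulmx_fiber x v :
  x != 0 -> (#|'rV[K]_m| * \sum_M (x *m M == v) = #|'M[K]_(n, m)|)%N.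
Proof.
move=> x_neq0.
have free_x : row_free x by rewrite -row_leq_rank lt0n mxrank_eq0.
have fiberE (w : 'rV_m) : (\sum_M (x *m M == w) = \sum_M (x *m M == v))%N.
  (* As [x] is row free, its product with [pinvmx x *m (w - v)] is [w - v]. *)
  rewrite (reindex_inj (addrI (pinvmx x *m (w - v)))) /=.
  apply: eq_bigr => M _; rewrite mulmxDr mulmxA mulmxVp // mul1mx.
  by rewrite -addrA -[X in _ == X]addr0 (inj_eq (addrI w)) addrC subr_eq0.
rewrite -sum_nat_const.
under eq_bigr => w _ do rewrite -(fiberE w).
rewrite exchange_big -sum1_card; apply: eq_bigr => M _ /=.
rewrite (bigD1 (x *m M)) //= eqxx big1 // => w.
by rewrite eq_sym => /negPf ->.
Qed.

(** A diagonal pair collides for every [M], any other pair for a fraction [1 / q] of the matrices;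
    the factor [q] on the left avoids division. *)
Lemma sum_collisions_mulmx (F : 'rV[K]_n -> 'rV[K]_m) :
  (#|'rV[K]_m| * \sum_M collisions (fun x => (F x + x *m M)%R)
   = #|'rV[K]_n| * (#|'rV[K]_m| + #|'rV[K]_n|.-1) * #|'M[K]_(n, m)|)%N.
Proof.
rewrite /collisions exchange_big /= big_distrr /= -mulnA -sum_nat_const.
apply: eq_bigr => x _; rewrite exchange_big /= (bigD1 x) //=.
under eq_bigr => M _ do rewrite eqxx.
rewrite sum1_card mulnDr mulnDl; congr addn.
rewrite big_distrr /= -(cardC1 x) -sum_nat_const; apply: eq_bigr => x' x'x.
(* A collision of [x] and [x'] means [(x - x') *m M = F x' - F x]. *)
rewrite -(card_mulmx_fiber (F x' - F x) (x := x - x')) ?subr_eq0 1?eq_sym //.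
congr muln; apply: eq_bigr => M _; congr nat_of_bool.
rewrite mulmxBl -subr_eq0 -[RHS]subr_eq0; congr (_ == 0).
by rewrite !opprD !opprK addrACA addrC [- F x' + _]addrC.
Qed.

Lemma exists_mulmx_surjective (F : 'rV[K]_n -> 'rV[K]_m) :
  (2 * m <= n)%N ->
  exists M, forall y, exists x, F x + x *m M = y.
Proof.
move=> le_m_n; pose G M x := F x + x *m M.
have [/existsP[M /forallP surj] | /existsPn noM] :=
    boolP [exists M, [forall y, y \in G M @: 'rV[K]_n]].
  by exists M => y; have /imsetP[x _ ->] := surj y; exists x.
have collM M : (#|'rV[K]_n| ^ 2 <= #|'rV[K]_m|.-1 * collisions (G M))%N.
  have /forallPn[y yG] := noM M.
  apply: leq_trans (card_sqr_leq_collisions (G M)) _; rewrite leq_mul2r.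
  rewrite -(cardC1 y); apply/orP; right; apply/subset_leq_card/subsetP => z zG.
  by apply: contraNneq yG => <-.
have q_gt0 : (0 < #|'rV[K]_m|)%N by apply/card_gt0P; exists 0.
have N_gt0 : (0 < #|'rV[K]_n|)%N by apply/card_gt0P; exists 0.
have T_gt0 : (0 < #|'M[K]_(n, m)|)%N by apply/card_gt0P; exists 0.
have le_qN : (#|'rV[K]_m| ^ 2 <= #|'rV[K]_n|)%N.
  rewrite !card_mx !mul1n -expnM mulnC leq_exp2l //.
  exact: card_finNzRing_gt1.
have := @leq_sum _ (index_enum _) xpredT _ _ (fun M _ => collM M).
rewrite sum_nat_const -big_distrr /= -(leq_pmul2l q_gt0) mulnCA.
rewrite [leqRHS]mulnCA sum_collisions_mulmx.
move: le_qN q_gt0 N_gt0 T_gt0.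
set T := #|'M[K]_(n, m)|; set N := #|'rV[K]_n|; set q := #|'rV[K]_m|.
move: T N q => T N [//|r] /= le_qN _ N_gt0 T_gt0 le_TN.
have NT_gt0 : (0 < N * T)%N by rewrite muln_gt0 N_gt0.
(* Here [q = r + 1]; cancelling [N * T] leaves an inequality equivalent to [N <= r ^ 2], against
   [(r + 1) ^ 2 <= N]. *)
have {le_TN} : (N * r.+1 <= r * (r.+1 + N.-1))%N.
  rewrite -(leq_pmul2l NT_gt0).
  by move: le_TN; congr leq; ring.
nia.
Qed.

End RandomMatrix.

Theorem theorem4p6 (p n m : nat) (p_prime : prime p) (le_m_n : (2 * m <= n)%N)
    (F : 'rV['F_p]_n -> 'rV['F_p]_m) :
  exists L : {linear 'rV['F_p]_n -> 'rV['F_p]_m},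
    forall y : 'rV['F_p]_m, exists x : 'rV['F_p]_n, F x + L x = y.
Proof.
have [M surj] := exists_mulmx_surjective F le_m_n.
by exists (mulmxr M).
Qed.
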